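(* Let $\mathbf{D}:\mathbb{N}\to\mathbb{N}$ be a monotonic function and let $\gamma=\langle(\mu_1,b_1),\ldots,(\mu_r,b_r)\rangle$ be a finite sequence of pairs (derivative, positive integer). Suppose that for each $i\in\mathbb{N}$, $\Lambda_i$ is an autoreduced set in $K\{X_{[n]}\}_{\leq\mathbf{D}(i)}$ such that $\Gamma(\Lambda_i)$ begins with $\gamma$. Then there is an $i<\mathfrak{h}_{n,m}(\mathbf{D},\gamma)$ such that $\Gamma(\Lambda_{i+1})$ does not have lower rank than $\Gamma(\Lambda_i)$.
   Context: **Differential setting.** $K$ is a field of characteristic $0$ with a set $\Delta=\{\delta_1,\ldots,\delta_m\}$ ($m\ge1$) of commuting derivations; $\Theta=\{\delta_1^{k_1}\cdots\delta_m^{k_m}\}$; $K\{X_{[n]}\}$ is the differential polynomial ring in $n\ge 1$ differential indeterminates. A derivative is an expression $\theta X_i$, $\theta\in\Theta$. Derivatives are ordered by the orderly ranking: $\delta_1^{k_1}\cdots\delta_m^{k_m}X_r<\delta_1^{l_1}\cdots\delta_m^{l_m}X_s$ iff $(\sum_i k_i,k_1,\ldots,k_m,r)$ is lexicographically smaller than $(\sum_i l_i,l_1,\ldots,l_m,s)$. Let $Z_1<Z_2<\cdots$ list all derivatives in increasing order, so $K\{X_{[n]}\}=K[Z_1,Z_2,\ldots]$. $K\{X_{[n]}\}_{\le b}$ is the set of polynomials in $Z_1,\ldots,Z_b$ of total degree $\le b$. For $f\notin K$: the leader $\mu_f$ is the greatest derivative occurring in $f$; the rank of $f$ is the pair $(\mu_f,\deg_{\mu_f}f)$,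 ranks compared lexicographically. $f$ is reduced with respect to $g\notin K$ if no proper derivative of $\mu_g$ occurs in $f$ and $\deg_{\mu_g}f<\deg_{\mu_g}g$. A set of elements of $K\{X_{[n]}\}\setminus K$ is autoreduced if each of its elements is reduced with respect to every other one (such sets are finite). For $\Lambda=\{f_1,\ldots,f_r\}$ autoreduced listed by ascending rank, $\Gamma(\Lambda)$ is the sequence of ranks of $f_1,\ldots,f_r$. A sequence $\gamma_1$ of length $r$ has lower rank than $\gamma_2$ of length $s$ if either at the first position where they differ (within $\min\{r,s\}$) the entry of $\gamma_1$ is smaller, or $s>r$ and $\gamma_1$ is an initial segment of $\gamma_2$. **The function $\mathfrak{h}_{n,m}$.** A bad leader sequence is a finite sequence of derivatives $\langle u_1,\ldots,u_k\rangle$ with $u_1<\cdots<u_k$ and no $i<j$, $\theta\in\Theta$ with $\theta u_i=u_j$; there is no infinite one. Identify the derivative $Z_u$ with the number $u\ge1$ (so $u=0$ is not a derivative). For $\gamma=\langle(\mu_1,b_1),\ldots,(\mu_r,b_r)\rangle$ put $\gamma_\mu=\langle\mu_1,\ldots,\mu_r\rangle$ (a bad leader sequence when $\gamma$ is an initial segment of some $\Gamma(\Lambda)$); for $\mathbf{D}:\mathbb{N}\to\mathbb{N}$ put $\mathbf{D}_{i_0}(i)=\mathbf{D}(i_0+i)$. Define $\mathfrak{h}_{n,m}(\mathbf{D},\gamma)$ by recursion on $\gamma_\mu$: if $\gamma_\mu$ is maximal (no extension by one derivative is a bad leader sequence), $\mathfrak{h}_{n,m}(\mathbf{D},\gamma)=1$.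 Otherwise set $w_{\mathbf{D}(1)}=1$ and, going down from $u=\mathbf{D}(1)$ to $u=0$: if $\gamma_\mu{}^\frown\langle u\rangle$ is not a bad leader sequence, $w_{u-1}=w_u$; if it is, put $v_{u,\mathbf{D}(w_u)}=w_u$, $v_{u,k-1}=v_{u,k}+\mathfrak{h}_{n,m}(\mathbf{D}_{v_{u,k}},\gamma^\frown\langle(u,k)\rangle)$ for $k=\mathbf{D}(w_u),\ldots,1$, and $w_{u-1}=v_{u,0}$. Then $\mathfrak{h}_{n,m}(\mathbf{D},\gamma)=w_{-1}$. *)

(* Defs.v *)
From mathcomp Require Import all_boot all_order all_algebra.
From mathcomp Require Import finmap.
From mathcomp Require Import monalg.
From Stdlib Require Import ClassicalEpsilon FunctionalExtensionality Wellfounded Bool.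

Set Implicit Arguments.
Unset Strict Implicit.
Unset Printing Implicit Defensive.

Import Order.TTheory GRing.Theory.

Local Open Scope nat_scope.

(* The operator delta_1^{k_1} ... delta_m^{k_m} is its tuple of exponents, and
   the derivative theta X_i is the pair (theta, i). *)
Notation diffop m := (m.-tuple nat).
Notation derivative n m := (diffop m * 'I_n)%type.

Section Derivatives.

Context {n m : nat}.
Implicit Types (u v : derivative n m) (theta : diffop m).

Definition diffop1 : diffop m := [tuple 0 | i < m].

Definition apply_op theta u : derivative n m :=
  ([tuple tnth theta i + tnth u.1 i | i < m], u.2).

Definition is_derivative u v : bool :=
  (u.2 == v.2) && [forall i, tnth u.1 i <= tnth v.1 i].

Lemma is_derivativeP u v :
  reflect (exists theta, apply_op theta u = v) (is_derivative u v).
Proof.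
apply: (iffP andP) => [[/eqP e /forallP le]|[theta <-]].
  exists [tuple tnth v.1 i - tnth u.1 i | i < m].
  case: u v e le => [a i] [b j] /= -> le; congr pair; apply: eq_from_tnth => k.
  by rewrite !tnth_mktuple subnK.
by split=> //; apply/forallP => i; rewrite tnth_mktuple leq_addl.
Qed.

Definition is_proper_derivative u v : bool := is_derivative u v && (u != v).

Lemma is_proper_derivativeP u v :
  reflect (exists2 theta, theta != diffop1 & apply_op theta u = v)
          (is_proper_derivative u v).
Proof.
have apply1 : apply_op diffop1 u = u.
  case: u => a i; congr pair; apply: eq_from_tnth => k.
  by rewrite !tnth_mktuple add0n.
apply: (iffP andP) => [[/is_derivativeP[theta <-] ne]|[theta ne e]].
  by exists theta => //; apply: contra_neq ne => ->.
split; first by apply/is_derivativeP; exists theta.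
apply: contra_neq ne => euv; apply: eq_from_tnth => k.
have := congr1 (fun w : derivative n m => tnth w.1 k) e.
rewrite -euv !tnth_mktuple => /eqP.
by rewrite -{2}[tnth u.1 k]add0n eqn_add2r => /eqP.
Qed.

Definition op_order theta : nat := sumn theta.

(* The orderly ranking: (order, k_1, ..., k_m, index) is compared
   lexicographically; all keys have the same length. *)
Definition ranking_key u : seq nat := op_order u.1 :: rcons u.1 u.2.
Definition deriv_lt u v : bool := (ranking_key u < ranking_key v :> seqlexi nat)%O.
Definition deriv_le u v : bool := (ranking_key u <= ranking_key v :> seqlexi nat)%O.

Definition derivs_upto (N : nat) : seq (derivative n m) :=
  [seq u <- [seq (map_tuple (@nat_of_ord N.+1) k, i) |
              k <- enum {: m.-tuple 'I_N.+1}, i <- enum 'I_n] | op_order u.1 <= N].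

(* [nthderiv u] is Z_u (Z_0 is undefined).  When n, m > 0 there are more than p
   derivatives of order at most p, and they form an initial segment. *)
Definition nthderiv (u : nat) : option (derivative n m) :=
  if u is p.+1 then onth (sort deriv_le (derivs_upto p)) p else None.

Definition rank_lt (x y : derivative n m * nat) : bool :=
  deriv_lt x.1 y.1 || (x.1 == y.1) && (x.2 < y.2).
Definition rank_le (x y : derivative n m * nat) : bool := (x == y) || rank_lt x y.

(* Convention: a proper initial segment has lower rank than the sequences that
   extend it (not higher, as in much of the literature on characteristic sets). *)
Definition lower_rank (s t : seq (derivative n m * nat)) : Prop :=
  (exists p x y s1 t1, [/\ s = p ++ x :: s1, t = p ++ y :: t1 & rank_lt x y])
  \/ (size s < size t /\ prefix s t).

Definition bad_leader_seq (s : seq (derivative n m)) : bool :=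
  sorted deriv_lt s && pairwise (fun u v => ~~ is_derivative u v) s.

Definition leaders (g : seq (derivative n m * nat)) : seq (derivative n m) := map fst g.

Definition maximal_leaders (s : seq (derivative n m)) : Prop :=
  forall u, ~~ bad_leader_seq (rcons s u).

Definition extends (g' g : seq (derivative n m * nat)) : Prop :=
  exists2 x, g' = rcons g x & bad_leader_seq (leaders g').

End Derivatives.

Section Enumeration.

Context {n m : nat}.
Implicit Types (d e : derivative n m).

Lemma ranking_key_inj : injective (@ranking_key n m).
Proof.
move=> [a i] [b j] /= [_ /eqP]; rewrite eqseq_rcons => /andP[/eqP eab /eqP eij].
by congr pair; apply: val_inj.
Qed.

Lemma deriv_le_trans : transitive (@deriv_le n m).
Proof. by move=> y x z; apply: le_trans. Qed.

Lemma deriv_le_anti : antisymmetric (@deriv_le n m).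
Proof. by move=> x y /le_anti/ranking_key_inj. Qed.

Lemma deriv_le_total : total (@deriv_le n m).
Proof. by move=> x y; apply: le_total. Qed.

Lemma deriv_ltE d e : deriv_lt d e = (d != e) && deriv_le d e.
Proof. by rewrite /deriv_lt lt_neqAle (inj_eq ranking_key_inj). Qed.

Lemma deriv_le_order d e : deriv_le d e -> op_order d.1 <= op_order e.1.
Proof. by rewrite /deriv_le /ranking_key lexi_cons => /andP[]. Qed.

Lemma mem_derivs_upto N d : (d \in derivs_upto N) = (op_order d.1 <= N).
Proof.
rewrite mem_filter andb_idr // => dN.
apply/allpairsP; exists ([tuple inord (tnth d.1 k) | k < m], d.2).
rewrite !mem_enum; split=> //; case: d dN => a i /= aN; congr pair.
apply: eq_from_tnth => k; rewrite tnth_map tnth_mktuple inordK // ltnS.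
apply: leq_trans aN; rewrite /op_order sumnE big_tuple (bigD1 k) //=.
exact: leq_addr.
Qed.

Lemma uniq_derivs_upto N : uniq (@derivs_upto n m N).
Proof.
apply/filter_uniq/allpairs_uniq; rewrite ?enum_uniq //.
move=> [a i] [b j] _ _ /= [/(inj_map val_inj) eab ->].
by congr pair; apply/val_inj.
Qed.

Lemma prefix_derivs N M : N <= M ->
  prefix (sort deriv_le (derivs_upto N)) (sort deriv_le (@derivs_upto n m M)).
Proof.
move=> NM; set s := sort _ (derivs_upto M); pose P d := op_order d.1 <= N.
have ss : sorted deriv_le s by apply: sort_sorted; exact: deriv_le_total.
suff <- : filter P s = sort deriv_le (derivs_upto N).
  elim: s ss => //= x s IH ss; have sS := path_sorted ss.
  have [Px|nPx] := boolP (P x); first by rewrite /= eqxx IH.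
  suff -> : filter P s = [::] by [].
  apply/eqP; rewrite -(negbK (_ == _)) -has_filter; apply/hasPn => y ys.
  have := allP (order_path_min deriv_le_trans ss) _ ys => /deriv_le_order le.
  by apply: contra nPx; apply: leq_trans.
apply: (sorted_eq deriv_le_trans deriv_le_anti).
- exact: sorted_filter deriv_le_trans _ _ ss.
- by apply: sort_sorted; exact: deriv_le_total.
apply: uniq_perm; rewrite ?filter_uniq ?sort_uniq ?uniq_derivs_upto // => d.
rewrite mem_filter !mem_sort !mem_derivs_upto /P andb_idr //.
by move/leq_trans; apply.
Qed.

Lemma onth_prefix (T : eqType) (s t : seq T) p x :
  prefix s t -> onth s p = Some x -> onth t p = Some x.
Proof.
move=> /prefixP[r ->]; rewrite onth_cat => e.
by have := onthTE s p; rewrite e => <-.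
Qed.

(* [nthderiv] is the increasing enumeration, without gaps, of all derivatives. *)
Lemma nthderiv_lt u v d e :
  nthderiv u = Some d -> nthderiv v = Some e -> deriv_lt d e = (u < v).
Proof.
case: u v => // p [|q] //= /(onth_prefix (prefix_derivs (leq_maxl p q))).
move=> ep /(onth_prefix (prefix_derivs (leq_maxr p q))) eq.
set s := sort _ _ in ep eq; rewrite ltnS.
have ps : p < size s by rewrite -onthTE ep.
have qs : q < size s by rewrite -onthTE eq.
have {}ep : nth d s p = d by apply: onth_nth.
have {}eq : nth d s q = e by apply: onth_nth.
rewrite -{1}ep -eq deriv_ltE.
have us : uniq s by rewrite sort_uniq uniq_derivs_upto.
rewrite nth_uniq // ltn_neqAle.
have sl : sorted deriv_le s by apply: sort_sorted; exact: deriv_le_total.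
have [//|/eqP pq /=] := eqVneq p q.
have refl : reflexive (@deriv_le n m) by move=> x; apply: lexx.
have nl := sorted_leq_nth deriv_le_trans refl d sl.
apply/idP/idP => [le|]; last exact: nl.
rewrite leqNgt; apply/negP => /ltnW qp; apply: pq.
apply/eqP; rewrite -(nth_uniq d ps qs us); apply/eqP/deriv_le_anti.
by rewrite le nl.
Qed.

Lemma nthderiv_defined u : 0 < n -> 0 < m -> 0 < u -> @nthderiv n m u.
Proof.
case: u => // p n0 m0 _ /=; rewrite onthTE size_sort.
pose i0 : 'I_m := Ordinal m0.
pose d k : derivative n m := ([tuple k * (i == i0) | i < m], Ordinal n0).
have order_d k : op_order (d k).1 = k.
  rewrite /op_order sumnE big_tuple (bigD1 i0) //= tnth_mktuple eqxx muln1.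
  by rewrite big1 ?addn0 // => i /negPf ne; rewrite tnth_mktuple ne muln0.
rewrite -(size_iota 0 p.+1) -(size_map d); apply: uniq_leq_size.
  rewrite map_inj_uniq ?iota_uniq // => j k /(congr1 (fun x => op_order x.1)).
  by rewrite !order_d.
by move=> _ /mapP[k + ->]; rewrite mem_iota mem_derivs_upto order_d.
Qed.

Lemma nthderiv_surj d : 0 < m -> exists u, nthderiv u = Some d.
Proof.
move=> m0; have n0 : 0 < n by case: d.2 => i; apply: leq_ltn_trans.
pose s := sort deriv_le (@derivs_upto n m (op_order d.1)); pose p := index d s.
have ds : d \in s by rewrite mem_sort mem_derivs_upto.
have ep : onth s p = Some d.
  by rewrite onthE (nth_map d) ?index_mem // nth_index.
exists p.+1; have := @nthderiv_defined p.+1 n0 m0 isT.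
rewrite /=; case e: onth => [x|] // _; rewrite -ep.
have := onth_prefix (prefix_derivs (leq_maxl p (op_order d.1))) e.
have := onth_prefix (prefix_derivs (leq_maxr p (op_order d.1))) ep.
by rewrite ep => -> [->].
Qed.

End Enumeration.

Section WellFounded.

Let nondec (f : nat -> nat) := forall i j, i <= j -> f i <= f j.
Let increasing (g : nat -> nat) := forall i j, i < j -> g i < g j.

Lemma nondec_subseq (f : nat -> nat) :
  exists2 g, increasing g & nondec (fun i => f (g i)).
Proof.
have ex_min N : exists j, N <= j /\ forall k, N <= k -> f j <= f k.
  suff H b : forall j, N <= j -> f j <= b ->
      exists j, N <= j /\ forall k, N <= k -> f j <= f k by apply: (H (f N) N).
  elim: b => [|b IH] j Nj fj.
    by exists j; split=> // k _; move: fj; rewrite leqn0 => /eqP ->.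
  case: (classic (exists2 k, N <= k & f k <= b)) => [[k Nk fk]|no].
    exact: IH Nk fk.
  exists j; split=> // k Nk; rewrite (leq_trans fj) // ltnNge.
  by apply/negP => fk; apply: no; exists k.
pose J N := proj1_sig (constructive_indefinite_description _ (ex_min N)).
have JP N : N <= J N /\ forall k, N <= k -> f (J N) <= f k.
  by rewrite /J; case: constructive_indefinite_description.
pose g i := iter i (fun x => J x.+1) (J 0).
have gS i : g i < g i.+1 by case: (JP (g i).+1).
have gf i : exists2 N, g i = J N & N <= g i.
  by case: i => [|i]; [exists 0|exists (g i).+1] => //; case: (JP (g i).+1).
have ginc : increasing g 
  by move=> i j; apply: (homo_ltn (r := fun a b => a < b)) i j => //; exact: ltn_trans.
exists g => // i0 j0.
apply: (homo_leq (f := fun i => f (g i)) (r := leq)) i0 j0 => [x|x y z|i] //.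
  exact: leq_trans.
have [N gi Ni] := gf i; rewrite [in X in X <= _]gi.
by apply: (JP N).2; apply: leq_trans Ni (ltnW (gS i)).
Qed.

Lemma nondec_subseq_all (F : seq (nat -> nat)) :
  exists2 g, increasing g & forall f, List.In f F -> nondec (fun i => f (g i)).
Proof.
elim: F => [|f F [g ginc gF]]; first by exists id.
have [h hinc hf] := nondec_subseq (fun i => f (g i)).
exists (fun i => g (h i)) => [i j ij|f' /= [<- //|inF] i j ij].
  exact/ginc/hinc.
apply: (gF _ inF); move: ij; rewrite leq_eqVlt => /predU1P[-> //|/hinc].
exact: ltnW.
Qed.

Lemma dickson n m (u : nat -> derivative n m) :
  exists i j, i < j /\ is_derivative (u i) (u j).
Proof.
pose F := [:: (fun i => (u i).2 : nat), (fun i => n - (u i).2)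
            & [seq (fun i => tnth (u i).1 k) | k <- enum 'I_m]].
have [g ginc gF] := nondec_subseq_all F.
exists (g 0), (g 1); split; first exact: ginc.
have F1 := gF _ (or_introl erefl) 0 1 isT.
have F2 := gF _ (or_intror (or_introl erefl)) 0 1 isT.
rewrite /= in F1 F2; apply/andP; split.
  rewrite -val_eqE eqn_leq F1 /=.
  by rewrite leqNgt; apply/negP => lt; move: F2; rewrite leqNgt ltn_sub2l.
apply/forallP => k; apply: (gF (fun i => tnth (u i).1 k) _ 0 1 isT).
right; right; have: k \in enum 'I_m by rewrite mem_enum.
elim: (enum 'I_m) => // k' s IH; rewrite inE => /predU1P[->|/IH]; [by left|].
by right.
Qed.

Lemma wf_extends n m : well_founded (@extends n m).
Proof.
move=> g0; apply: NNPP => nacc.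
pose T := {g : seq (derivative n m * nat) | ~ Acc extends g}.
have step (g : T) : exists g' : T, extends (sval g') (sval g).
  apply: NNPP => no; apply: (svalP g); constructor => g' eg.
  by apply: NNPP => na; apply: no; exists (exist _ g' na).
pose next g := proj1_sig (constructive_indefinite_description _ (step g)).
have nextP g : extends (sval (next g)) (sval g).
  by rewrite /next; case: constructive_indefinite_description.
pose G i := sval (iter i next (exist _ g0 nacc : T)).
have GS i : extends (G i.+1) (G i) by exact: nextP.
have ex i : exists x, G i.+1 = rcons (G i) x by have [x e _] := GS i; exists x.
pose x i := proj1_sig (constructive_indefinite_description _ (ex i)).
have xP i : G i.+1 = rcons (G i) (x i).
  by rewrite /x; case: constructive_indefinite_description.
have [i [j [ij dij]]] := dickson (fun i => (x i).1).
have inG k : i < k -> (x i).1 \in leaders (G k).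
  elim: k => // k IH; rewrite ltnS leq_eqVlt xP /leaders map_rcons mem_rcons.
  by rewrite inE => /predU1P[->|/IH ->]; rewrite ?eqxx ?orbT.
have [_ _ /andP[_]] := GS j.
rewrite xP /leaders map_rcons pairwise_rcons => /andP[/allP /(_ _ (inG _ ij))].
by rewrite dij.
Qed.

End WellFounded.

Section TheBound.

Context {n m : nat}.

Definition shift (v : nat) (D : nat -> nat) : nat -> nat := fun i => D (v + i).

(* In both loops [H u k D'] stands for h(D', gamma^<(u, k)>).
   [loop_deg] takes v_{u,k} to v_{u,0}; [loop_leader] takes w_u to w_{-1}. *)
Fixpoint loop_deg (H : nat -> (nat -> nat) -> nat) (D : nat -> nat) (k v : nat) :=
  if k is k'.+1 then loop_deg H D k' (v + H k (shift v D)) else v.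

Fixpoint loop_leader (H : derivative n m -> nat -> (nat -> nat) -> nat)
    (s : seq (derivative n m)) (D : nat -> nat) (u w : nat) : nat :=
  let w' := if nthderiv u is Some d then
              if bad_leader_seq (rcons s d) then loop_deg (H d) D (D w) w else w
            else w in
  if u is u'.+1 then loop_leader H s D u' w' else w'.

Lemma extends_rcons (g : seq (derivative n m * nat)) x :
  bad_leader_seq (leaders (rcons g x)) -> extends (rcons g x) g.
Proof. by exists x. Qed.

(* The value 0 is never used: [loop_leader] only looks at bad extensions. *)
Definition h_step (g : seq (derivative n m * nat))
    (rec : forall g', extends g' g -> (nat -> nat) -> nat) (D : nat -> nat) : nat :=
  if excluded_middle_informative (maximal_leaders (leaders g)) then 1
  else loop_leader
         (fun d k => match sumbool_of_bool (bad_leader_seq (leaders (rcons g (d, k)))) with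
                     | left bad => rec _ (extends_rcons bad)
                     | right _ => fun _ => 0
                     end)
         (leaders g) D (D 1) 1.

Definition h (D : nat -> nat) (g : seq (derivative n m * nat)) : nat :=
  Fix (@wf_extends n m) (fun _ => (nat -> nat) -> nat) h_step g D.

Lemma eq_loop_leader H1 H2 s D u w :
  (forall d k, bad_leader_seq (rcons s d) -> H1 d k =1 H2 d k) ->
  loop_leader H1 s D u w = loop_leader H2 s D u w.
Proof.
move=> eqH; have eq_deg d k v : bad_leader_seq (rcons s d) ->
    loop_deg (H1 d) D k v = loop_deg (H2 d) D k v.
  by move=> bad; elim: k v => //= k IH v; rewrite IH eqH.
elim: u w => [|u IH] w //=; case: onth => [d|]; rewrite IH //.
by case: ifP => // bad; rewrite eq_deg.
Qed.

Lemma hE D g :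
  h D g = if excluded_middle_informative (maximal_leaders (leaders g)) then 1
          else loop_leader (fun d k D' => h D' (rcons g (d, k)))
                           (leaders g) D (D 1) 1.
Proof.
rewrite {1}/h Fix_eq; last first.
  move=> g' f f' eqf; congr h_step; apply: functional_extensionality_dep => x.
  by apply: functional_extensionality_dep => y; apply: eqf.
rewrite /h_step -/(h _ _); destruct excluded_middle_informative => //.
apply: eq_loop_leader => d k bad D'.
by case: sumbool_of_bool => // nbad; move: (nbad); rewrite /leaders map_rcons bad.
Qed.

End TheBound.

Definition derivation (K : fieldType) (d : K -> K) : Prop :=
  (forall a b, d (a + b) = d a + d b)%R /\
  (forall a b, d (a * b) = d a * b + a * d b)%R.

(* K{X_[n]} as the polynomial ring over K in the derivatives.  Its own
   derivations are not needed: leaders, ranks and reduction only refer to the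
   action of the operators on derivatives. *)
Notation diffpoly K n m := {malg K[{cmonom (derivative n m)}]}.

Section DiffPoly.

Context {K : fieldType} {n m : nat}.
Implicit Types (f g : diffpoly K n m) (u : derivative n m).

Definition in_base f : Prop := exists c : K, f = c%:MP%R.

Definition occurring f : {fset derivative n m} :=
  (\bigcup_(t <- msupp f) finsupp t)%fset.

Definition deg_in u f : nat := \max_(t <- msupp f) t u.

Definition total_deg f : nat := \max_(t <- msupp f) mdeg t.

(* K{X_[n]}_{<= b} *)
Definition bounded (b : nat) f : Prop :=
  (forall u, u \in occurring f -> exists2 k, k <= b & nthderiv k = Some u)
  /\ total_deg f <= b.

(* [None] exactly when f lies in K. *)
Definition leader f : option (derivative n m) :=
  ohead (sort (fun u v => deriv_le v u) (occurring f)).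

Definition poly_rank f : option (derivative n m * nat) :=
  omap (fun u => (u, deg_in u f)) (leader f).

(* For g outside K, which is the only case where it is used. *)
Definition reduced f g : bool :=
  if leader g is Some u then
    [forall v : occurring f, ~~ is_proper_derivative u (val v)]
    && (deg_in u f < deg_in u g)
  else false.

Definition autoreduced (L : {fset diffpoly K n m}) : Prop :=
  (forall f, f \in L -> ~ in_base f) /\
  (forall f g, f \in L -> g \in L -> f != g -> reduced f g).

(* Gamma(L) *)
Definition rank_seq (L : {fset diffpoly K n m}) : seq (derivative n m * nat) :=
  sort rank_le (pmap poly_rank L).

End DiffPoly.

(* Main.v *)
Require Import Defs.
From mathcomp Require Import all_boot all_order all_algebra.
From mathcomp Require Import finmap monalg.
From Stdlib Require Import ClassicalEpsilon.

Set Implicit Arguments.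
Unset Strict Implicit.
Unset Printing Implicit Defensive.

Import Order.TTheory.

Local Open Scope nat_scope.

(** The bound [h D g] dominates the length of every strictly descending run of
    rank sequences that begin with [g], the i-th of which uses only derivatives
    [Z_k] with [k <= D i] and degrees at most [D i].  The polynomials matter
    only through this: the rank sequence of an autoreduced set has a bad leader
    sequence as its leaders, and its entries obey the bound on the polynomials
    ([rank_seq_admissible]).  The rest is an induction on [g] along the
    well-founded relation [extends] ([lower_rank_descent_short]).

    Look at the entry that follows [g] in each sequence of the run.  As the run
    descends this entry can only decrease, and once absent it stays absent
    ([lower_rank_onth]).  The two loops defining [h] run through its possible
    values (Z_u, k) from the top downwards.  While the entry equals (Z_u, k) the
    run is a run of sequences beginning with [rcons g (Z_u, k)], so the
    induction hypothesis bounds the time spent there by exactly the increment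
    that the inner loop makes.  Hence each loop counter is a time by which the
    value in question has been passed ([loop_degP], [loop_leaderP]); values
    that would spoil the bad leader sequence never occur and cost nothing.

    Time has to be shifted by one.  The counter starts at 1 and the entry is
    controlled at time [w.-1] when the counter is [w]; the block entered with
    counter [v] is then a run starting at time [v.-1], and it obeys the bound
    [shift v D] because [D] is monotone.  When the outer loop ends with
    [w = h D g], the sequence at time [w.-1] is [g] itself, and no sequence
    beginning with [g] is lower than [g] ([descent_next_last]), so the run
    cannot make its step from [w.-1] to [w]. *)

(** * Ranks and the lowering of rank sequences *)

Lemma prefix_rcons_onth (T : eqType) (g s : seq T) x :
  prefix g s -> onth s (size g) = Some x -> prefix (rcons g x) s.
Proof.
move=> /prefixP[t ->]; rewrite onth_cat ltnn subnn.
by case: t => //= _ t [->]; rewrite -cat_rcons prefix_prefix.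
Qed.

Section RankOrder.

Context {n m : nat}.
Implicit Types (d e : derivative n m) (x y z : derivative n m * nat).
Implicit Types (s t g : seq (derivative n m * nat)).

Lemma deriv_lt_irr : irreflexive (@deriv_lt n m).
Proof. by move=> d; rewrite /deriv_lt ltxx. Qed.

Lemma deriv_lt_trans : transitive (@deriv_lt n m).
Proof. by move=> e d d'; apply: lt_trans. Qed.

Lemma rank_lt_irr : irreflexive (@rank_lt n m).
Proof. by move=> x; rewrite /rank_lt deriv_lt_irr eqxx ltnn. Qed.

Let key x : (seqlexi nat *l nat)%type := (ranking_key x.1, x.2).

(** Ranks are compared lexicographically, so [rank_le] inherits transitivity,
    totality and antisymmetry from the lexicographic product order. *)
Lemma rank_leE x y : rank_le x y = (key x <= key y)%O.
Proof.
case: x y => [d k] [e l]; rewrite /rank_le /rank_lt /key xpair_eqE.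
rewrite lexi_pair -leEnat -/(deriv_le d e) -/(deriv_le e d) deriv_ltE /=.
have [<-|ne] := eqVneq d e.
  by rewrite /deriv_le lexx /= leEnat [in RHS]leq_eqVlt.
rewrite /= orbF; case de: (deriv_le d e) => //=.
case ed: (deriv_le e d) => //=; case/eqP: ne.
by apply: deriv_le_anti; rewrite de.
Qed.

Lemma rank_le_trans : transitive (@rank_le n m).
Proof. by move=> y x z; rewrite !rank_leE; apply: le_trans. Qed.

Lemma rank_le_total : total (@rank_le n m).
Proof. by move=> x y; rewrite !rank_leE; apply: le_total. Qed.

Lemma rank_le_anti : antisymmetric (@rank_le n m).
Proof.
move=> [d k] [e l]; rewrite !rank_leE => /le_anti E; congr pair.
  by apply: ranking_key_inj; apply: (congr1 fst E).
exact: (congr1 snd E).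
Qed.

Lemma rank_le_pred x d k :
  rank_le x (d, k.+1) -> x != (d, k.+1) -> rank_le x (d, k).
Proof.
case: x => [e l] + ne; rewrite {1}/rank_le (negPf ne) /rank_le /rank_lt /=.
rewrite xpair_eqE ltnS leq_eqVlt.
by do !case: (_ == _); case: (deriv_lt _ _); case: (l < k).
Qed.

(** Sequences with the common prefix [g] first differ at or after position
    [size g], so the entry there cannot grow and cannot appear from nothing when
    the rank is lowered. *)
Lemma lower_rank_onth g s t y :
  prefix g s -> prefix g t -> lower_rank t s -> onth t (size g) = Some y ->
  exists2 x, onth s (size g) = Some x & rank_le y x.
Proof.
move=> gs gt [[p [a [b [t1 [s1 [et es ab]]]]]]|[_ ts]] ey; last first.
  by exists y; [apply: onth_prefix ey|rewrite /rank_le eqxx].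
have [lt|gtp|eqp] := ltngtP (size p) (size g).
- (* A difference inside the common prefix would be a rank below itself. *)
  have at_p u c u1 : prefix g u -> u = p ++ c :: u1 -> onth g (size p) = Some c.
    move=> /prefixP[w ->] /(congr1 (fun v => onth v (size p))).
    by rewrite !onth_cat lt ltnn subnn.
  by move: ab; have := at_p _ _ _ gs es; rewrite (at_p _ _ _ gt et) => -[->];
    rewrite rank_lt_irr.
- by exists y; [rewrite es onth_cat gtp -ey et onth_cat gtp|rewrite /rank_le eqxx].
exists b; first by rewrite es onth_cat eqp ltnn subnn.
move: ey; rewrite et onth_cat eqp ltnn subnn => -[<-].
by rewrite /rank_le ab orbT.
Qed.

Lemma rank_le_index x y j k :
  nthderiv j = Some x.1 -> nthderiv k = Some y.1 -> rank_le x y -> j <= k.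
Proof.
move=> ej ek xy; rewrite leqNgt -(nthderiv_lt ek ej); apply/negP => yx.
move: xy yx; rewrite /rank_le /rank_lt => /predU1P[->|/orP[xy|/andP[/eqP-> _]]].
- by rewrite deriv_lt_irr.
- by move=> /(deriv_lt_trans xy); rewrite deriv_lt_irr.
- by rewrite deriv_lt_irr.
Qed.

Lemma bad_leader_prefix s t :
  prefix s t -> bad_leader_seq (leaders t) -> bad_leader_seq (leaders s).
Proof.
move=> /prefixP[w ->] /andP[]; rewrite /leaders map_cat => /cat_sorted2[st _].
by rewrite pairwise_cat /bad_leader_seq st => /and3P[].
Qed.

End RankOrder.

(** * Descending runs and the two loops *)

Section Loops.

Context {n m : nat}.
Implicit Types (d : derivative n m) (D : nat -> nat).

Lemma loop_deg_ge H D k v : v <= loop_deg H D k v.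
Proof. by elim: k v => //= k IH v; apply: leq_trans (IH _); apply: leq_addr. Qed.

Lemma loop_leader_ge (H : derivative n m -> nat -> (nat -> nat) -> nat) s D u w :
  w <= loop_leader H s D u w.
Proof.
elim: u w => //= u IH w; apply: leq_trans (IH _).
by case: onth => // d; case: ifP => // _; apply: loop_deg_ge.
Qed.

End Loops.

(** What an autoreduced set of polynomials of K{X_[n]}_{<= b} imposes on its
    rank sequence. *)
Definition admissible {n m} (b : nat) (s : seq (derivative n m * nat)) : Prop :=
  bad_leader_seq (leaders s) /\
  forall x, x \in s -> 0 < x.2 <= b /\ exists2 k, k <= b & nthderiv k = Some x.1.

(** A fixed descending run G 0, ..., G N of sequences beginning with [g]. *)
Section Descent.

Context {n m : nat} (m_gt0 : 0 < m) (g : seq (derivative n m * nat)).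
Context (D : nat -> nat) (D_mono : {homo D : i j / i <= j}).
Context (G : nat -> seq (derivative n m * nat)) (N : nat).
Context (G_adm : forall i, i <= N -> admissible (D i) (G i)).
Context (G_g : forall i, i <= N -> prefix g (G i)).
Context (G_desc : forall i, i < N -> lower_rank (G i.+1) (G i)).

Let next i := onth (G i) (size g).

Let next_anti i j y : i <= j <= N -> next j = Some y ->
  exists2 x, next i = Some x & rank_le y x.
Proof.
elim: j y => [|j IH] y /andP[].
  by rewrite leqn0 => /eqP-> _; exists y; rewrite // /rank_le eqxx.
rewrite leq_eqVlt => /predU1P[-> _ ey|ij jN ey].
  by exists y; rewrite // /rank_le eqxx.
have [x ex yx] := lower_rank_onth (G_g (ltnW jN)) (G_g jN) (G_desc jN) ey.
have [|z ez xz] := IH x _ ex; first by rewrite -ltnS ij ltnW.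
by exists z => //; apply: rank_le_trans xz.
Qed.

Let next_in i x : next i = Some x -> x \in G i.
Proof. by move=> e; apply/onthP; exists (size g). Qed.

(** [g] is the lowest of the sequences beginning with [g], hence only the last
    member of a descending run can be [g] itself. *)
Lemma descent_next_last : 0 < N -> next N.-1 <> None.
Proof.
move=> N0; case: N N0 G_g G_desc => // M _ Gg Gd /= eM.
have eqg i : i <= M.+1 -> next i = None -> G i = g.
  move=> /Gg/prefixP[t e] /eqP; rewrite /next e onth_cat ltnn subnn.
  by case: t {e} => //=; rewrite cats0.
have := Gd M (ltnSn _); rewrite (eqg M) //.
case eS: (next M.+1) => [y|].
  move=> low; have [x] := lower_rank_onth (prefix_refl g) (Gg _ (leqnn _)) low eS.
  by rewrite onth_default.
rewrite (eqg M.+1) // => -[|[]]; last by rewrite ltnn.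
move=> [p [x [y [s [t [es et]]]]]]; move: et; rewrite {1}es => /eqP.
by rewrite eqseq_cat // eqxx => /eqP[-> _]; rewrite rank_lt_irr.
Qed.

(** The induction hypothesis on extensions of [g], in the form in which the
    loops use it: starting from time [v.-1], the run cannot go on beginning with
    [rcons g (d, k)] as long as the inner loop waits. *)
Context (block : forall d k v, bad_leader_seq (rcons (leaders g) d) ->
  0 < v -> v + h (shift v D) (rcons g (d, k)) <= N ->
  exists2 i, v.-1 <= i < v + h (shift v D) (rcons g (d, k))
           & ~~ prefix (rcons g (d, k)) (G i)).

Let H d k D' := h D' (rcons g (d, k)).

(** Each round of the inner loop waits until the entry has dropped below
    (d, k); after the round for degree 1 its leader is below [d], because the
    degrees in a rank sequence are positive. *)
Lemma loop_degP d k v : bad_leader_seq (rcons (leaders g) d) ->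
  0 < v -> loop_deg (H d) D k v <= N ->
  (forall y, next v.-1 = Some y -> rank_le y (d, k)) ->
  forall y, next (loop_deg (H d) D k v).-1 = Some y -> deriv_lt y.1 d.
Proof.
move=> bad; elim: k v => [|k IH] v v0 /= vN cap y.
  move=> ey; have [_ /(_ y (next_in ey))[y0 _]] := G_adm (leq_trans (leq_pred _) vN).
  move: (cap y ey); rewrite /rank_le /rank_lt.
  by move: y0; case: y {ey} => e [|l] //= _; rewrite xpair_eqE !andbF !orbF.
set v' := v + _ in vN *.
have v'N : v' <= N := leq_trans (loop_deg_ge _ _ _ _) vN.
have vv' : v <= v' := leq_addr _ _.
apply: IH => // [|{}y ey]; first exact: leq_trans vv'.
have range i : v.-1 <= i < v' -> i <= v'.-1 <= N.
  move=> /andP[_ iv]; rewrite (leq_trans (leq_pred _) v'N) andbT.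
  by rewrite -ltnS (ltn_predK iv).
have vlt : v.-1 < v' by rewrite prednK.
have [|z ez yz] := @next_anti v.-1 _ _ _ ey; first by apply: range; rewrite leqnn.
(* If the entry were still (d, k.+1) at the end of the round, it would have been
   squeezed to that value during the whole round. *)
apply: rank_le_pred (rank_le_trans yz (cap _ ez)) _; apply/eqP => eyd.
have [i vi /negP] := @block d k.+1 v bad v0 v'N; apply.
have iN : i <= N by case/andP: (range i vi) => a; apply: leq_trans.
have [x ex yx] := @next_anti i _ _ (range i vi) ey.
apply: prefix_rcons_onth; first exact: G_g.
rewrite -/(next i) ex -eyd; congr Some; apply: rank_le_anti; rewrite yx andbT.
have [|z' + xz'] := @next_anti v.-1 _ _ _ ex.
  by case/andP: vi => vi _; rewrite vi.
by rewrite ez => -[ez']; rewrite eyd (rank_le_trans xz') // -ez' cap.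
Qed.

(** The outer loop lowers the index of the leader of the entry down to 0, which
    is the index of no derivative, so that at the end there is no entry. *)
Lemma loop_leaderP u w : 0 < w -> loop_leader H (leaders g) D u w <= N ->
  (forall y, next w.-1 = Some y -> exists2 k, k <= u & nthderiv k = Some y.1) ->
  next (loop_leader H (leaders g) D u w).-1 = None.
Proof.
elim: u w => [|u IH] w w0 /= wN cap.
  case e: (next _) => [y|] //; have [k] := cap _ e.
  by rewrite leqn0 => /eqP->.
set w' := (X in loop_leader _ _ _ _ X) in wN *.
have w'N : w' <= N := leq_trans (loop_leader_ge _ _ _ _ _) wN.
have ww' : w <= w'.
  by rewrite /w'; case: onth => // d; case: ifP => // _; apply: loop_deg_ge.
apply: IH => // [|y ey]; first exact: leq_trans ww'.
have [|z ez yz] := @next_anti w.-1 _ _ _ ey.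
  rewrite (leq_trans (leq_pred _) w'N) andbT.
  by rewrite -ltnS !prednK // (leq_trans w0).
have [k ku ek] := cap z ez.
have [j ej] := nthderiv_surj y.1 m_gt0.
have := leq_trans (rank_le_index ej ek yz) ku.
rewrite leq_eqVlt => /predU1P[ju|]; last by exists j.
have {}ej : onth (sort deriv_le (derivs_upto u)) u = Some y.1 by rewrite -ej ju.
have [bad|nbad] := boolP (bad_leader_seq (rcons (leaders g) y.1)).
  have ew' : w' = loop_deg (H y.1) D (D w) w by rewrite /w' ej bad.
  (* The inner loop for the leader y.1 has left that leader behind. *)
  suff: deriv_lt y.1 y.1 by rewrite deriv_lt_irr.
  apply: (@loop_degP y.1 (D w) w); rewrite -?ew' // => x ex.
  have {}[k' ku' ek'] := cap x ex.
  have wN' : w.-1 <= N := leq_trans (leq_pred _) (leq_trans ww' w'N).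
  have [_ /(_ x (next_in ex))[/andP[_ xD] _]] := G_adm wN'.
  have {}xD : x.2 <= D w by apply: leq_trans xD (D_mono (leq_pred _)).
  rewrite /rank_le /rank_lt /= (nthderiv_lt (v := u.+1) ek' ej).
  move: ku'; rewrite leq_eqVlt => /predU1P[ku'|->]; last by rewrite orbT.
  have {ek'}/eqP : Some x.1 = Some y.1 by rewrite -ek' ku'.
  case: x {ex} xD => x b /= bD /eqP[->].
  by move: bD; rewrite xpair_eqE !eqxx leq_eqVlt => /orP[]->; rewrite ?orbT.
have y_le := leq_trans (leq_pred _) w'N.
have pre := prefix_rcons_onth (G_g y_le) ey.
have [/(bad_leader_prefix pre) + _] := G_adm y_le.
by rewrite /leaders map_rcons (negPf nbad).
Qed.

End Descent.

(** The hypotheses on the run stop at time [h D g], which is what lets the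
    induction hypothesis apply to a block, during which the run begins with
    a longer sequence for a limited time only. *)
Lemma lower_rank_descent_short n m (m_gt0 : 0 < m) (g : seq (derivative n m * nat)) D
    (G : nat -> seq (derivative n m * nat)) :
  {homo D : i j / i <= j} ->
  (forall i, i <= h D g -> admissible (D i) (G i)) ->
  (forall i, i <= h D g -> prefix g (G i)) ->
  ~ (forall i, i < h D g -> lower_rank (G i.+1) (G i)).
Proof.
elim/(well_founded_ind (@wf_extends n m)): g D G => g IH D G Dmono.
move NE: (h D g) => N Gadm Gg Gdesc.
move: NE; rewrite hE.
case: (excluded_middle_informative (maximal_leaders _)) => [maxg|nmaxg] /= NE.
  (* Nothing can follow g in an admissible sequence, so already G 0 is g. *)
  apply: (descent_next_last Gg Gdesc); first by rewrite -NE.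
  rewrite -NE /=; case e: (onth _ _) => [x|] //.
  have [/(bad_leader_prefix (prefix_rcons_onth (Gg 0 isT) e)) + _] := Gadm 0 isT.
  by rewrite /leaders map_rcons (negPf (maxg _)).
have N0 : 0 < N by rewrite -NE loop_leader_ge.
apply: (descent_next_last Gg Gdesc N0); rewrite -NE.
apply: (loop_leaderP m_gt0 Dmono Gadm Gg Gdesc); rewrite ?NE //; last first.
  move=> y e; have [_ adm0] := Gadm 0 isT.
  have yG : y \in G 0 by apply/onthP; exists (size g).
  have [_ [k kD ek]] := adm0 y yG; exists k => //.
  exact: leq_trans kD (Dmono 0 1 isT).
(* The block starts at time v.-1, not v: monotonicity of D absorbs the shift. *)
move=> d k v bad v0; set L := h _ _ => vN; apply: NNPP => stay.
have ext : extends (rcons g (d, k)) g.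
  by apply: extends_rcons; rewrite /leaders map_rcons.
have vi i : i <= L -> v.-1 + i < v + L.
  by move=> iL; rewrite -(ltn_predK v0) addSn ltnS leq_add2l.
have [] // := IH _ ext (shift v D) (fun i => G (v.-1 + i)).
- by move=> i j ij; apply: Dmono; rewrite leq_add2l.
- move=> i /vi/ltnW/leq_trans-/(_ _ vN)/Gadm [bad_i adm_i]; split=> // x.
  move=> /adm_i[/andP[-> xD] [j jD ej]].
  have DD : D (v.-1 + i) <= shift v D i.
    by apply: Dmono; rewrite leq_add2r leq_pred.
  by rewrite (leq_trans xD DD); split=> //; exists j => //; apply: leq_trans DD.
- move=> i iL; apply: NNPP => np; apply: stay; exists (v.-1 + i); last exact/negP.
  by rewrite leq_addr vi.
move=> i iL; rewrite addnS; apply: Gdesc; apply: leq_trans vN.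
exact/vi/ltnW.
Qed.

(** * Rank sequences of autoreduced sets *)

Section Autoreduced.

Context {K : fieldType} {n m : nat}.
Implicit Types (f : diffpoly K n m) (L : {fset diffpoly K n m}).

Lemma leader_occurring f u : leader f = Some u -> u \in occurring f.
Proof.
rewrite /leader => e; rewrite -(mem_sort (fun u v => deriv_le v u)).
by case: (sort _ _) e => //= v s [->]; rewrite mem_head.
Qed.

Lemma occurringP f u :
  reflect (exists2 t, t \in msupp f & 0 < t u) (u \in occurring f).
Proof.
apply: (iffP (bigfcupP _ _ _ _)) => -[t]; rewrite ?andbT => tf tu; exists t.
- by [].
- by move: tu; rewrite -cmE_neq0 lt0n.
- by rewrite tf.
by rewrite -cmE_neq0 -lt0n.
Qed.

Lemma deg_in_gt0 f u : u \in occurring f -> 0 < deg_in u f.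
Proof.
move=> /occurringP[t tf tu]; apply: leq_trans tu _.
exact: (leq_bigmax_seq _ tf isT).
Qed.

Lemma deg_in_le_total f u : deg_in u f <= total_deg f.
Proof.
apply/bigmax_leqP_seq => t tf _; apply: leq_trans (leq_bigmax_seq _ tf isT).
have [ut|] := boolP (u \in finsupp t); last by rewrite -cmE_eq0 => /eqP->.
by rewrite mdegE (big_fsetD1 u) //= leq_addr.
Qed.

Lemma rank_seqP L x :
  reflect (exists2 f, f \in L & poly_rank f = Some x) (x \in rank_seq L).
Proof.
rewrite mem_sort mem_pmap.
by apply: (iffP mapP) => -[f fL e]; exists f.
Qed.

Lemma poly_rankP f x : poly_rank f = Some x ->
  leader f = Some x.1 /\ x.2 = deg_in x.1 f.
Proof. by rewrite /poly_rank; case: leader => //= u [<-]. Qed.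

(** Equal leaders would make each of the two degrees smaller than the other;
    with distinct leaders, a derivative of the leader of [f] is a proper one, and
    it may not occur in [g]. *)
Lemma autoreduced_rank L f g x y : autoreduced L -> f \in L -> g \in L ->
  f != g -> poly_rank f = Some x -> poly_rank g = Some y ->
  (x.1 != y.1) && ~~ is_derivative x.1 y.1.
Proof.
move=> [_ red] fL gL fg /poly_rankP[lf _] /poly_rankP[lg _].
have := red g f gL fL; rewrite eq_sym fg => /(_ isT).
have := red f g fL gL fg.
rewrite /reduced lf lg => /andP[_ d1] /andP[/forallP no d2].
have ne : x.1 != y.1.
  apply/negP => /eqP e; move: d1; rewrite -e ltnNge => /negP; apply.
  exact: ltnW.
have := no [` leader_occurring lg]%fset.
by rewrite /is_proper_derivative ne /= andbT.
Qed.

Lemma rank_seq_admissible b L :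
  autoreduced L -> (forall f, f \in L -> bounded b f) ->
  admissible b (rank_seq L).
Proof.
move=> autoL bL; split; last first.
  move=> x /rank_seqP[f fL /poly_rankP[lf ->]].
  have [occ deg] := bL f fL; have xf := leader_occurring lf.
  split; last exact: occ.
  by rewrite deg_in_gt0 //= (leq_trans (deg_in_le_total _ _)).
have uL : uniq (rank_seq L).
  rewrite sort_uniq; have -> : pmap poly_rank L = pmap id (map poly_rank L).
    by elim: (enum_fset L) => //= f s ->.
  apply: (@pmap_uniq _ _ id Some) => //; first by case.
  rewrite map_inj_in_uniq ?fset_uniq // => f g fL gL efg.
  (* Reduction also guarantees a leader, so ranks cannot agree by both being
     undefined. *)
  apply/eqP; apply: contraT => fg.
  have := autoL.2 f g fL gL fg; rewrite /reduced.
  case lg: (leader g) => [u|] // _.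
  have eg : poly_rank g = Some (u, deg_in u g) by rewrite /poly_rank lg.
  have ef : poly_rank f = Some (u, deg_in u g) by rewrite efg.
  by have := autoreduced_rank autoL fL gL fg ef eg; rewrite eqxx.
have sL : sorted rank_le (rank_seq L).
  by apply: sort_sorted; exact: rank_le_total.
have : pairwise (fun x y => rank_le x y && (x != y)) (rank_seq L).
  rewrite (pairwise_relI rank_le (fun x y => x != y)).
  by rewrite -(sorted_pairwise rank_le_trans) sL -uniq_pairwise uL.
rewrite /bad_leader_seq /leaders (sorted_pairwise deriv_lt_trans) !pairwise_map.
rewrite -pairwise_relI; apply: (sub_in_pairwise (P := mem (rank_seq L))).
  move=> x y /rank_seqP[f fL ex] /rank_seqP[g gL ey] /andP[xy nxy].
  have fg : f != g.
    by apply: contra nxy => /eqP efg; move: ey; rewrite -efg ex => -[->].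
  have /andP[ne nd] := autoreduced_rank autoL fL gL fg ex ey.
  rewrite /= nd andbT; move: xy.
  by rewrite /rank_le /rank_lt (negPf nxy) (negPf ne) orbF.
exact/allP.
Qed.

End Autoreduced.

Theorem lemma5p31 (K : fieldType) (charK : [pchar K]%R =i pred0)
  (n m : nat) (n_gt0 : 0 < n) (m_gt0 : 0 < m)
  (delta : 'I_m -> K -> K)
  (delta_der : forall i, derivation (delta i))
  (delta_comm : forall i j a, delta i (delta j a) = delta j (delta i a))
  (D : nat -> nat) (D_mono : {homo D : i j / i <= j})
  (gamma : seq (derivative n m * nat)) (gamma_pos : all (fun x => 0 < x.2) gamma)
  (Lambda : nat -> {fset diffpoly K n m})
  (Lambda_auto : forall i, autoreduced (Lambda i))
  (Lambda_bounded : forall i f, f \in Lambda i -> bounded (D i) f)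
  (Lambda_gamma : forall i, prefix gamma (rank_seq (Lambda i))) :
  exists2 i, i < h D gamma &
    ~ lower_rank (rank_seq (Lambda i.+1)) (rank_seq (Lambda i)).
Proof.
apply: NNPP => none.
pose G i := rank_seq (Lambda i).
apply: (@lower_rank_descent_short n m m_gt0 gamma D G) => [//|i _|i _|i ih].
- by apply: rank_seq_admissible => // f; apply: Lambda_bounded.
- exact: Lambda_gamma.
by apply: NNPP => nlow; apply: none; exists i.
Qed.
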